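(* For every even integer $N\ge 4$, there exists a star-shaped polygon $P\subset\mathbb{R}^2$ with $N$ vertices, each of which is an irrational point (i.e. has at least one irrational coordinate), such that the Ehrhart function $L_P(t)$ is a polynomial in $t$ (so $P$ exhibits Ehrhart-theoretic period collapse).
   Context: For a closed (possibly non-convex) polygon $P\subset\mathbb{R}^2$ and a positive integer $t$, the Ehrhart function is $L_P(t)=\#(tP\cap\mathbb{Z}^2)$. A polygon exhibits Ehrhart-theoretic period collapse if it is not an integer polygon and $L_P(t)$, for positive integers $t$, is a polynomial in $t$. *)

(* Defs.v *)
From mathcomp Require Import all_boot all_order all_algebra.
From mathcomp Require Import finmap.
From mathcomp Require Import all_classical all_reals all_analysis.

Set Implicit Arguments.
Unset Strict Implicit.
Unset Printing Implicit Defensive.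

Import Order.TTheory GRing.Theory Num.Theory.
Import numFieldNormedType.Exports.

Local Open Scope classical_set_scope.
Local Open Scope ring_scope.

Section Polygons.
Variable R : realType.

Definition segment (a b : R * R) : set (R * R) :=
  [set (1 - s) *: a + s *: b | s in `[0, 1]].

Definition collinear (a b c : R * R) : Prop :=
  (b.1 - a.1) * (c.2 - a.2) = (b.2 - a.2) * (c.1 - a.1).

Definition star_shaped (A : set (R * R)) : Prop :=
  exists2 c, A c & forall x, A x -> segment c x `<=` A.

Section VertexCycle.
Variables (N : nat) (v : 'I_N -> R * R).

(* [ordS] is the successor modulo [N], so the last edge returns to the first
   vertex. *)
Definition edge (i : 'I_N) : set (R * R) := segment (v i) (v (ordS i)).

Definition boundary_curve : set (R * R) := \bigcup_(i in [set: 'I_N]) edge i.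

(* The noncollinearity clause excludes angles of 180 degrees, so that each of
   the [N] points is a genuine vertex. *)
Definition simple_polygon : Prop :=
  [/\ (3 <= N)%N,
      injective v,
      forall i, edge i `&` edge (ordS i) = [set v (ordS i)],
      forall i j, j != i -> j != ordS i -> i != ordS j ->
        edge i `&` edge j = set0 &
      forall i, ~ collinear (v i) (v (ordS i)) (v (ordS (ordS i)))].

(* The closed polygon: the curve together with its Jordan interior, i.e. the
   bounded connected components of its complement. *)
Definition region : set (R * R) :=
  boundary_curve `|`
  [set x | (~` boundary_curve) x /\
           bounded_set (connected_component (~` boundary_curve) x)].

End VertexCycle.

Definition int_lattice : set (R * R) :=
  [set z | z.1 \is a Num.int /\ z.2 \is a Num.int].

Definition irrational_point (x : R * R) : Prop :=
  irrational x.1 \/ irrational x.2.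

(* [fset_set] sends infinite sets to the empty set; this case does not arise
   for a bounded set [P]. *)
Definition ehrhart (P : set (R * R)) (t : nat) : nat :=
  #|` fset_set ([set t%:R *: x | x in P] `&` int_lattice) |%fset.

Definition ehrhart_polynomial (P : set (R * R)) : Prop :=
  exists p : {poly R}, forall t : nat, (0 < t)%N ->
    (ehrhart P t)%:R = p.[t%:R].

Definition integer_polygon (N : nat) (v : 'I_N -> R * R) : Prop :=
  forall i, int_lattice (v i).

Definition period_collapse (N : nat) (v : 'I_N -> R * R) : Prop :=
  ~ integer_polygon v /\ ehrhart_polynomial (region v).

End Polygons.

(* Main.v *)
Require Import Defs.
From mathcomp Require Import all_boot all_order all_algebra.
From mathcomp Require Import finmap.
From mathcomp Require Import all_classical all_reals all_analysis.
From mathcomp Require Import lra ring zify.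

(* For N = 2H + 2, let f be a convex piecewise linear function on [0, H] with
   rational data and a kink at each of 1, ..., H - 1, and take
   P = {(x, y) | 0 <= y <= H, pi + f(y) <= x <= pi + f(y) + m} with m a large
   integer.  The slice of tP at height k <= tH is an interval of length tm whose
   left end t pi + t f(k/t) is irrational, so it contains exactly tm integers,
   and L_P(t) = (tH + 1) tm.  The polygon is star-shaped once m dominates the
   variation of f.  To identify the region enclosed by the boundary curve, note
   that the open body is clopen in the complement of the curve and that a
   horizontal or vertical ray escapes from every point outside P. *)

Set Implicit Arguments.
Unset Strict Implicit.
Unset Printing Implicit Defensive.

Import Order.TTheory GRing.Theory Num.Theory.
Import numFieldNormedType.Exports.

Local Open Scope classical_set_scope.
Local Open Scope ring_scope.

(** * A convex piecewise linear function with kinks at integers *)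

Definition kinks (R : realType) (H : nat) (y : R) : R :=
  \sum_(j < H) `|y - j%:R|.

(** Each summand changes slope only at an integer [j], so the sign of [y - j] is constant between
    [i] and [i + 1]. *)
Lemma kinks_affine (R : realType) (H i : nat) (s : R) : 0 <= s <= 1 ->
  kinks H (i%:R + s) = (1 - s) * kinks H i%:R + s * kinks H i.+1%:R.
Proof.
move=> /andP[s0 s1]; rewrite /kinks !mulr_sumr -big_split.
apply: eq_bigr => j _ /=; rewrite -natr1; have [ji|ij] := leqP j i.
  have {}ji : j%:R <= i%:R :> R by rewrite ler_nat.
  by rewrite !ger0_norm; lra.
have {}ij : i%:R + 1 <= j%:R :> R by rewrite natr1 ler_nat.
by rewrite !ler0_norm; lra.
Qed.

(** There are [H] summands, each 1-Lipschitz. On [0, H] this bounds the variation by [H ^ 2], which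
    governs both boundedness and star-shapedness. *)
Lemma kinks_lipschitz (R : realType) (H : nat) (y z : R) :
  `|kinks H y - kinks H z| <= H%:R * `|y - z|.
Proof.
rewrite /kinks -sumrB; apply: le_trans (ler_norm_sum _ _ _) _.
rewrite mulr_natl -[in leRHS](card_ord H) -sumr_const; apply: ler_sum => j _.
by apply: le_trans (ler_dist_dist _ _) _; rewrite opprB addrA subrK.
Qed.

(** All second differences are nonnegative by convexity, and the summand with its kink at [i + 1],
    present because [i + 1 < H], contributes 2. This keeps three consecutive vertices of a wall from
    being collinear. *)
Lemma kinks_strict (R : realType) (H i : nat) : (i.+1 < H)%N ->
  2 * kinks H (i.+1%:R : R) < kinks H i%:R + kinks H i.+2%:R.
Proof.
move=> iH; rewrite -subr_gt0 /kinks mulr_sumr -big_split -sumrB /=.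
rewrite (bigD1 (Ordinal iH)) //= subrr normr0 mulr0 subr0.
apply: ltr_pwDl.
  by rewrite -!natr1 ltr0_norm ?ltr_pwDr// ?gtr0_norm//; lra.
apply: sumr_ge0 => j _; rewrite subr_ge0 -!natr1.
apply: le_trans (ler_normD _ _); rewrite -[leLHS]ger0_norm ?mulr_ge0//.
by rewrite normrM normr_id -normrM le_eqVlt; apply/predU1l; congr `|_|; ring.
Qed.

Lemma kinks_rational (R : realType) (H : nat) (q : rat) :
  exists r : rat, kinks H (ratr q : R) = ratr r.
Proof.
exists (\sum_(j < H) `|q - j%:R|); rewrite /kinks rmorph_sum /=.
by apply: eq_bigr => j _; rewrite ratr_norm rmorphB /= ratr_nat.
Qed.

(** * Horizontal segments and wall segments by equations and inequalities *)

Section Segments.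
Variable R : realType.

Lemma segmentC (a b : R * R) : segment a b = segment b a.
Proof.
suff sub (c d : R * R) : segment c d `<=` segment d c by apply/seteqP.
move=> p [s s01 <-]; exists (1 - s); last by rewrite subKr addrC.
by move: s01; rewrite /= !in_itv /=; lra.
Qed.

Lemma segment_horizontal (a w y : R) (p : R * R) : 0 < w ->
  segment (a, y) (a + w, y) p <-> p.2 = y /\ 0 <= p.1 - a <= w.
Proof.
move=> w0; split=> [[s /= + <-] /=|[<- /andP[p0 pw]]].
  rewrite in_itv /= /GRing.scale /= => /andP[s0 s1]; split; first by lra.
  by apply/andP; split; nra.
exists ((p.1 - a) / w).
  by rewrite /= in_itv /= divr_ge0 ?(ltW w0)//= ler_pdivrMr// mul1r.
by rewrite [RHS]surjective_pairing; congr pair; rewrite /= /GRing.scale /=;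
  field; rewrite gt_eqF.
Qed.

Definition wall (H : nat) (y : R) : R := pi + kinks H y.

(** The wall is affine between consecutive integer heights. The shift [c] is 0 for the left wall and
    the width for the right one. *)
Lemma segment_wall (H i : nat) (c : R) (p : R * R) :
  segment (wall H i%:R + c, i%:R) (wall H i.+1%:R + c, i.+1%:R) p <->
  p.1 = wall H p.2 + c /\ i%:R <= p.2 <= i%:R + 1.
Proof.
have wall_affine s : 0 <= s <= 1 ->
    wall H (i%:R + s) = (1 - s) * wall H i%:R + s * wall H i.+1%:R.
  by move=> s01; rewrite /wall kinks_affine//; ring.
split=> [[s /= + <-] /=|[p1 /andP[ip pi]]].
  rewrite in_itv /= /GRing.scale /= => s01; have /andP[s0 s1] := s01.
  have -> : (1 - s) * i%:R + s * i.+1%:R = i%:R + s by rewrite -natr1; ring.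
  by rewrite wall_affine//; split; [ring|lra].
have s01 : 0 <= p.2 - i%:R <= 1 by lra.
exists (p.2 - i%:R); first by rewrite /= in_itv.
have yE : p.2 = i%:R + (p.2 - i%:R) by ring.
rewrite [RHS]surjective_pairing p1; congr pair; rewrite /= /GRing.scale /=.
  by rewrite [in RHS]yE wall_affine//; ring.
by rewrite -natr1; ring.
Qed.

End Segments.

(** * The vertex cycle and its simplicity *)

Section Polygon.
Variables (R : realType) (H : nat).
Hypothesis H_gt0 : (0 < H)%N.

(** Four times the bound [H ^ 2] on the variation of a wall: the margin that star-shapedness uses.
    Being an integer, it gives every slice of an integer dilate an integer length. *)
Definition width : nat := 4 * H ^ 2.

Definition vertex (i : nat) : R * R :=
  if (i <= H)%N then (wall H i%:R, i%:R)
  else (wall H (H.*2.+1 - i)%:R + width%:R, (H.*2.+1 - i)%:R).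

(* Up the left wall, then down the right one. *)
Definition polygon (i : 'I_(H.+1).*2) : R * R := vertex i.

Let h : R := H%:R.
Let w : R := width%:R.

Let h_ge1 : 1 <= h.
Proof. by rewrite /h ler1n. Qed.

Let widthE : w = 4 * h * h.
Proof. by rewrite /w /width natrM natrX expr2 mulrA. Qed.

Let w_gt0 : 0 < w.
Proof. by rewrite widthE !mulr_gt0// /h ltr0n. Qed.

Let natr_lt (m n : nat) : (m < n)%N -> m%:R + 1 <= n%:R :> R.
Proof. by rewrite natr1 ler_nat. Qed.

Let natr_doubleS (m : nat) : m.*2.+1%:R = 2 * m%:R + 1 :> R.
Proof. by rewrite -natr1 -mul2n natrM. Qed.

(** The index is a real number here, so that incidences of edges become linear arithmetic with
    [wall H p.2] as an atom. On the right wall, edge [i] spans the heights from [2H - i] to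
    [2H + 1 - i]. *)
Variant edge_spec (i : R) (p : R * R) : Prop :=
| LeftEdge of i + 1 <= h & p.1 = wall H p.2 & i <= p.2 <= i + 1
| TopEdge of i = h & p.2 = h & 0 <= p.1 - wall H p.2 <= w
| RightEdge of h + 1 <= i & i <= 2 * h & p.1 = wall H p.2 + w
    & 2 * h <= i + p.2 <= 2 * h + 1
| BottomEdge of i = 2 * h + 1 & p.2 = 0 & 0 <= p.1 - wall H p.2 <= w.

Let ord_bound (i : 'I_(H.+1).*2) : (i <= H.*2.+1)%N.
Proof. by case: i => i /=; rewrite doubleS ltnS. Qed.

Lemma val_ordS (i : 'I_(H.+1).*2) :
  val (ordS i) = if i == H.*2.+1 :> nat then 0%N else i.+1.
Proof.
case: i => i /=; rewrite doubleS => iN; case: eqP => [->|i_neq].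
  by rewrite modnn.
by rewrite modn_small//; lia.
Qed.

Lemma edgeP (i : 'I_(H.+1).*2) (p : R * R) :
  edge polygon i p <-> edge_spec i%:R p.
Proof.
have h1 := h_ge1; have w0 := w_gt0.
rewrite /edge /polygon val_ordS /vertex.
have iN := ord_bound i.
have [iH|Hi|iH] := ltngtP i H.
- have iF : (i == H.*2.+1 :> nat) = false by lia.
  rewrite iF iH -[wall H i%:R]addr0 -[wall H i.+1%:R]addr0 segment_wall addr0.
  have := natr_lt iH; rewrite -/h => iH'.
  split=> [[? ?]|[] *]; [exact: LeftEdge| by []|exfalso; lra..].
- have [i_last|i_neq] := eqVneq (i : nat) H.*2.+1.
    rewrite i_last leq0n subnn segmentC segment_horizontal//.
    rewrite natr_doubleS -/h.
    split=> [[p2 pw]|[? ? ?|? ?|? ? ? ?|_ -> //]].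
      by apply: BottomEdge; rewrite ?p2.
    + by exfalso; lra.
    + by exfalso; lra.
    + by exfalso; lra.
  have iH : (i <= H.*2)%N by lia.
  rewrite (ltn_geF (leqW Hi)) subSS subSn// segmentC segment_wall.
  rewrite natrB// -[H.*2]mul2n natrM -/h -/w.
  have := natr_lt Hi; rewrite -/h => Hi'.
  have iH' : i%:R <= 2 * h by rewrite /h -natrM mul2n ler_nat.
  split=> [[? ?]|[] *]; [apply: RightEdge; lra| | |split; lra|]; exfalso; lra.
- have iF : (i == H.*2.+1 :> nat) = false by lia.
  rewrite iF iH ltnn subSS -addnn addnK segment_horizontal// -/h.
  split=> [[p2 pw]|[? ? ?|_ -> //|? ? ? ?|? ?]].
    by apply: TopEdge; rewrite ?p2.
  + by exfalso; lra.
  + by exfalso; lra.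
  + by exfalso; lra.
Qed.

Lemma vertex_left (i : nat) (p : R * R) : (i <= H)%N ->
  p.2 = i%:R -> p.1 = wall H p.2 -> p = vertex i.
Proof. by move=> iH p2 p1; rewrite [p]surjective_pairing p1 p2 /vertex iH. Qed.

Lemma vertex_right (i : nat) (p : R * R) : (H < i <= H.*2.+1)%N ->
  i%:R + p.2 = 2 * h + 1 -> p.1 = wall H p.2 + w -> p = vertex i.
Proof.
move=> /andP[Hi iH] p2 p1; rewrite [p]surjective_pairing p1 /vertex leqNgt Hi.
by rewrite /= natrB// natr_doubleS -/h -p2 [_ + p.2]addrC addrK.
Qed.

Lemma polygon_inj : injective polygon.
Proof.
move=> i j; have iN := ord_bound i; have jN := ord_bound j.
rewrite /polygon /vertex => ij; apply/val_inj => /=; move: ij.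
case: leqP => iH; case: leqP => jH.
- by case=> _ /eqP; rewrite eqr_nat => /eqP.
- by case=> + ijE; rewrite -ijE => e; exfalso; have := w_gt0; rewrite /w; lra.
- by case=> + ijE; rewrite -ijE => e; exfalso; have := w_gt0; rewrite /w; lra.
- by case=> _ /eqP; rewrite eqr_nat => /eqP; lia.
Qed.

Lemma edge_source (i : 'I_(H.+1).*2) : edge polygon i (polygon i).
Proof.
exists 0; first by rewrite /= in_itv /= lexx ler01.
by rewrite subr0 scale1r scale0r addr0.
Qed.

Lemma edge_target (i : 'I_(H.+1).*2) : edge polygon i (polygon (ordS i)).
Proof.
exists 1; first by rewrite /= in_itv /= lexx ler01.
by rewrite subrr scale1r scale0r add0r.
Qed.

Lemma edge_adjacent (i : 'I_(H.+1).*2) :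
  edge polygon i `&` edge polygon (ordS i) = [set polygon (ordS i)].
Proof.
have h1 := h_ge1; have w0 := w_gt0.
apply/seteqP; split=> p /=; last first.
  by move=> ->; split; [exact: edge_target|exact: edge_source].
move=> [/edgeP pi /edgeP]; rewrite /polygon val_ordS.
have iN := ord_bound i.
case: eqP => [i_last|i_neq].
  move: pi; rewrite i_last natr_doubleS -/h => pi pS.
  by apply: vertex_left; rewrite ?leq0n//; case: pi => *; case: pS => *; lra.
have {}iN : (i <= H.*2)%N by lia.
rewrite -natr1 => pS; have [iH|Hi] := ltnP i H.
  have := natr_lt iH; rewrite -/h => iH'.
  by apply: vertex_left; rewrite -?natr1//; case: pi => *; case: pS => *; lra.
have Hi' : h <= i%:R by rewrite /h ler_nat.
apply: vertex_right; rewrite -?natr1 ?ltnS ?Hi//;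
 by case: pi => *; case: pS => *; lra.
Qed.

Lemma edge_disjoint (i j : 'I_(H.+1).*2) :
  j != i -> j != ordS i -> i != ordS j ->
  edge polygon i `&` edge polygon j = set0.
Proof.
have h1 := h_ge1; have w0 := w_gt0.
wlog ij : i j / (i < j)%N.
  move=> wlog_lt ji jSi iSj; have [ij|ij|/val_inj ij] := ltngtP i j.
  - exact: wlog_lt.
  - by rewrite setIC; apply: wlog_lt; rewrite // eq_sym.
  - by rewrite ij eqxx in ji.
move=> _ jSi iSj; apply/seteqP; split=> // p [/edgeP pi /edgeP pj].
have jN : (j <= H.*2.+1)%N by exact: ord_bound.
have ij2 : (i.+1 < j)%N.
  rewrite ltn_neqAle ij andbT; apply: contraNneq jSi => jE.
  by apply/eqP/val_inj; rewrite val_ordS ifN ?jE//; lia.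
(* With [i < j], the only cyclically adjacent pair not excluded by [ij2] consists of the first and
   the last edge. *)
have ends : (0 < i)%N || (j < H.*2.+1)%N.
  apply: contraNT iSj; rewrite negb_or -leqNgt leqn0 -leqNgt.
  move=> /andP[/eqP i0 jl].
  by apply/eqP/val_inj; rewrite val_ordS ifT//; lia.
have := natr_lt ij2; rewrite -natr1 => {}ij2.
have {jN}jN : j%:R <= 2 * h + 1 by rewrite -natr_doubleS ler_nat.
have i0 : 0 <= i%:R :> R by [].
have {ends}ends : 1 <= i%:R :> R \/ j%:R + 1 <= 2 * h + 1.
  case/orP: ends => [i1|/natr_lt jl]; first by left; rewrite ler1n.
  by right; rewrite -natr_doubleS.
by case: pi => *; case: pj => *; case: ends => *; lra.
Qed.

(** Three consecutive vertices either lie on one wall, where strict convexity applies, or span one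
    horizontal and one non-horizontal edge. *)
Lemma polygon_noncollinear (i : 'I_(H.+1).*2) :
  ~ collinear (polygon i) (polygon (ordS i)) (polygon (ordS (ordS i))).
Proof.
have h1 := h_ge1; have w0 := w_gt0; have iN := ord_bound i.
have strict k : (k.+1 < H)%N ->
    2 * wall H k.+1%:R < wall H k%:R + wall H k.+2%:R :> R.
  by move=> /(@kinks_strict R); rewrite /wall; lra.
rewrite /collinear /polygon !val_ordS.
have [i_last|i_neq] := eqVneq (i : nat) H.*2.+1.
  rewrite /vertex i_last /= H_gt0 ltn_geF ?subnn/=; last by lia.
  by rewrite -/w; lra.
have [i_pred|i_neq2] := eqVneq i.+1 H.*2.+1.
  rewrite (_ : i = H.*2 :> nat); last by lia.
  have HH : (H < H.*2)%N by lia.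
  rewrite /vertex (ltn_geF HH) (ltn_geF (leqW HH)) leq0n subSnn subnn /=.
  by rewrite -/w; lra.
have [iH|Hi|iH] := ltngtP i.+1 H.
- rewrite /vertex iH (ltnW iH) (ltnW (ltnW iH)) /= -!natr1.
  have := strict _ iH; rewrite -!natr1.
  by lra.
- have [iH|Hi'] := leqP i H.
    have {}iH : i = H :> nat by lia.
    rewrite /vertex iH leqnn ltnn (ltn_geF (leqnSn _)).
    rewrite (_ : (H.*2.+1 - H.+1 = H)%N); last by lia.
    rewrite (_ : (H.*2.+1 - H.+2 = H.-1)%N); last by lia.
    have h_pred : H.-1%:R = h - 1.
      rewrite /h -[in RHS](prednK H_gt0).
      by rewrite -natr1 addrK.
    by rewrite -/w /= h_pred -/h; lra.
  (* All three vertices lie on the right wall, and [k] is the height of the lowest. *)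
  have [k kE] : exists k, (i + k = H.*2.-1)%N by exists (H.*2.-1 - i)%N; lia.
  rewrite /vertex (ltn_geF Hi') (ltn_geF (leqW Hi')).
  rewrite (ltn_geF (leqW (leqW Hi'))).
  rewrite (_ : (H.*2.+1 - i = k.+2)%N); last by lia.
  rewrite (_ : (H.*2.+1 - i.+1 = k.+1)%N); last by lia.
  rewrite (_ : (H.*2.+1 - i.+2 = k)%N); last by lia.
  have := strict k; rewrite -/w /= -!natr1 => /(_ ltac:(lia)); lra.
- have hE : h = i%:R + 1 by rewrite natr1 iH.
  rewrite /vertex iH leqnn ltnn (_ : i <= H)%N /=; last by lia.
  rewrite (_ : (H.*2.+1 - H.+1 = H)%N); last by lia.
  by rewrite -/h -/w hE; lra.
Qed.

Lemma polygon_simple : simple_polygon polygon.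
Proof.
split.
- by rewrite doubleS; lia.
- exact: polygon_inj.
- exact: edge_adjacent.
- exact: edge_disjoint.
- exact: polygon_noncollinear.
Qed.

End Polygon.

(** * Bounded and unbounded components of the complement of a curve *)

Section Topology.
Variable R : realType.

Lemma kinks_continuous (H : nat) : continuous (@kinks R H).
Proof.
apply: continuous_big => [|j _]; first exact: add_continuous.
move=> y; apply: cvg_norm; apply: cvgB => //; exact: cvg_cst.
Qed.

(** The ray is the continuous image of an interval, hence connected, so the component of its origin
    contains all of it. *)
Lemma ray_unbounded (A : set (R * R)) (x d : R * R) : d != 0 ->
  (forall s, 0 <= s -> A (x + s *: d)) ->
  ~ bounded_set (connected_component A x).
Proof.
move=> d0 xdA [M [_ /(_ (M + 1)) Mb]].
have {Mb}Mb p : connected_component A x p -> `|p| <= M + 1.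
  by apply: Mb; rewrite ltrDl.
pose ray := (fun s : R => x + s *: d) @` `[0, +oo[.
have xray : ray x by exists 0; rewrite /= ?in_itv /= ?lexx// scale0r addr0.
have rayA : ray `<=` A.
  by move=> _ [s + <-]; rewrite /= in_itv /= andbT; exact: xdA.
have cray : connected ray.
  apply: connected_continuous_connected; last first.
    apply: continuous_subspaceT => s.
    by apply: cvgD; [exact: cvg_cst | apply: cvgZr_tmp].
  apply/connected_intervalP => a b; rewrite /= !in_itv /= !andbT.
  move=> a0 _ c /andP[ac _].
  by rewrite in_itv /= andbT (le_trans a0 ac).
have nd : 0 < `|d| by rewrite normr_gt0.
(* At this parameter [s *: d] has norm [|M| + 2 + |x|], so the point of the ray has norm at least
   [|M| + 2], above the supposed bound [M + 1]. *)
pose s := (`|M| + 2 + `|x|) / `|d|.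
have s0 : 0 <= s by rewrite divr_ge0// !addr_ge0.
have : `|x + s *: d| <= M + 1.
  apply/Mb/(connected_component_max xray rayA cray).
  by exists s; rewrite //= in_itv /= s0.
have : `|s *: d| <= `|x + s *: d| + `|x|.
  rewrite -[X in `|X| <= _](addKr x) addrC.
  by apply: le_trans (ler_normB _ _) _.
rewrite normrZ (ger0_norm s0) /s divfK ?gt_eqF//.
have := ler_norm M; lra.
Qed.

(** For a point of [Q] off the curve, the component [C] meets [S] and [Q] in the same set. That set
    is relatively open and closed in [C], so it is all of [C], and [C] inherits the boundedness of
    [S]. *)
Lemma region_eq (N : nat) (v : 'I_N -> R * R) (Q S : set (R * R)) :
  closed Q -> open S -> bounded_set S -> S `<=` Q ->
  (forall p, boundary_curve v p <-> Q p /\ ~ S p) ->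
  (forall p, ~ Q p ->
    ~ bounded_set (connected_component (~` boundary_curve v) p)) ->
  region v = Q.
Proof.
move=> cQ oS bS SQ boundE unbounded; apply/seteqP; split=> p.
  move=> [/boundE[]//|[_ bounded_p]]; apply: contrapT => nQp.
  exact: unbounded bounded_p.
move=> Qp; have [bp|nbp] := pselect (boundary_curve v p); [by left|right].
split=> //; set C := connected_component _ p.
have CS q : C q -> Q q -> S q.
  move=> /connected_component_sub nbq Qq; apply: contrapT => nSq.
  by apply: nbq; apply/boundE.
suff CE : C `&` S = C.
  case: bS => M [Mreal SM]; exists M; split=> // M' /SM{}SM q.
  by rewrite -CE => -[_]; exact: SM.
have Cp : C p by exact: connected_component_refl.
have CSQ : C `&` S = C `&` Q.
  by apply/seteqP; split=> q [Cq ?]; split=> //; [exact: SQ|exact: CS].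
apply: (@component_connected _ (~` boundary_curve v) p).
- by exists p; split=> //; exact: CS.
- by exists S.
- by exists Q.
Qed.

End Topology.

(** * The enclosed region and its star shape *)

Section Body.
Variables (R : realType) (H : nat).
Hypothesis H_gt0 : (0 < H)%N.

Let h : R := H%:R.
Let w : R := (width H)%:R.

Let h_ge1 : 1 <= h.
Proof. by rewrite /h ler1n. Qed.

Let widthE : w = 4 * h * h.
Proof. by rewrite /w /width natrM natrX expr2 mulrA. Qed.

Let gap (p : R * R) : R := p.1 - wall H p.2.

Definition body : set (R * R) :=
  [set p | 0 <= p.2 <= H%:R /\ 0 <= p.1 - wall H p.2 <= (width H)%:R].

Definition body_interior : set (R * R) :=
  [set p | 0 < p.2 < H%:R /\ 0 < p.1 - wall H p.2 < (width H)%:R].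

Lemma gap_continuous : continuous gap.
Proof.
move=> p; apply: cvgB; first exact: cvg_fst.
apply: (@continuous_comp _ _ _ snd (wall H)); first exact: cvg_snd.
by apply: cvgD; [exact: cvg_cst|exact: kinks_continuous].
Qed.

Let snd_cont : continuous (@snd R R).
Proof. by move=> p; exact: cvg_snd. Qed.

Lemma body_closed : closed body.
Proof.
rewrite (_ : body = (snd @^-1` `[0, h]) `&` (gap @^-1` `[0, w])).
  apply: closedI; [move/continuous_closedP: snd_cont|
                   move/continuous_closedP: gap_continuous];
  by apply; exact: interval_closed.
by apply/seteqP; split=> p /=; rewrite !in_itv.
Qed.

Lemma body_interior_open : open body_interior.
Proof.
rewrite (_ : body_interior = (snd @^-1` `]0, h[) `&` (gap @^-1` `]0, w[)).
  apply: openI; [move/continuousP: snd_cont|move/continuousP: gap_continuous];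
  by apply; exact: interval_open.
by apply/seteqP; split=> p /=; rewrite !in_itv.
Qed.

Lemma wall_lipschitz (y z : R) : `|wall H y - wall H z| <= h * `|y - z|.
Proof. by rewrite opprD addrACA subrr add0r kinks_lipschitz. Qed.

Lemma body_bounded : bounded_set body.
Proof.
(* The first three terms bound the abscissa, by the Lipschitz estimate from height 0 plus the width;
   the last bounds the height. *)
exists (`|wall H 0 : R| + h * h + w + h); split; first exact: num_real.
move=> M /ltW CM p [/andP[y0 yh] /andP[g0 gw]].
have := wall_lipschitz p.2 0; rewrite subr0 (ger0_norm y0) => lip.
have {}lip : `|wall H p.2 - wall H 0| <= h * h.
  by apply: le_trans lip _; rewrite ler_wpM2l// ?(le_trans _ h_ge1).
have h1 := h_ge1.
have hh : 0 <= h * h by rewrite mulr_ge0//; lra.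
have w0 : 0 <= w by [].
have a0 : - `|wall H 0 : R| <= wall H 0 <= `|wall H 0 : R|.
  by rewrite -ler_norml.
move: lip; rewrite ler_norml => lip.
rewrite /= prod_normE ge_max !ler_norml; move: gw; rewrite -/w => gw.
move: yh; rewrite -/h => yh.
by apply/andP; split; lra.
Qed.

(** Each edge turns one of the four inequalities defining [body] into an equality; conversely, the
    inequality that is tight selects the kind of edge, and the height selects its index. *)
Lemma boundary_curveE (p : R * R) :
  boundary_curve (@polygon R H) p <-> body p /\ ~ body_interior p.
Proof.
have index_bounds k : (k <= H)%N ->
    [/\ k < H.+1.*2, H.*2 - k < H.+1.*2 & k <= H.*2]%N.
  by move=> kH; split; lia.
have h1 := h_ge1.
have h2 : 0 < h * h by rewrite mulr_gt0//; lra.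
have wE := widthE.
rewrite /body /body_interior /= -/h -/w; split.
  move=> [i _ /(edgeP H_gt0)] []; rewrite -/h -/w.
  - move=> ? -> ?; have ? : 0 <= i%:R :> R by [].
    by rewrite subrr ltxx; split; [split|case]; lra.
  - by move=> _ -> ?; rewrite ltxx; split; [split|rewrite andbF => -[]]; lra.
  - move=> ? ? -> ?; rewrite addrAC subrr add0r ltxx andbF.
    by split; [split|case]; lra.
  - by move=> _ -> ?; rewrite ltxx; split; [split|case]; lra.
move=> [[y_bound g_bound] nint].
have in_edge i : (i < H.+1.*2)%N -> edge_spec H i%:R p ->
    boundary_curve (@polygon R H) p.
  by move=> iN pE; exists (Ordinal iN) => //; apply/edgeP.
(* The floor of the height serves except at the top, where it would be [H]; there [H - 1] is
   taken. *)
have floor_y : exists2 k, (k < H)%N & k%:R <= p.2 <= k%:R + 1.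
  have /andP[y0 _] := y_bound; have [yh|hy] := ltP p.2 h.
    have /andP[ky yk] := truncn_itv y0; exists (Num.truncn p.2).
      by rewrite -(@ltr_nat R); exact: le_lt_trans yh.
    by rewrite ky natr1 ltW.
  have hP : H.-1%:R = h - 1 by rewrite /h -[in RHS](prednK H_gt0) -natr1 addrK.
  by exists H.-1; [rewrite prednK|rewrite hP; lra].
have [k kH k_y] := floor_y; have [kN kN' k2H] := index_bounds _ (ltnW kH).
have kh : k%:R + 1 <= h by rewrite natr1 ler_nat.
have k0 : 0 <= k%:R :> R by [].
have [y0|y0] := eqVneq p.2 0.
  apply: (in_edge H.*2.+1); first by rewrite doubleS.
  by apply: BottomEdge; rewrite // -natr1 -mul2n natrM.
have [yh|yh] := eqVneq p.2 h.
  have [HN _ _] := index_bounds _ (leqnn H); apply: (in_edge H HN).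
  exact: TopEdge.
have [g0|g0] := eqVneq (p.1 - wall H p.2) 0.
  by apply: (in_edge k kN); apply: LeftEdge; rewrite // -/h; lra.
have [gw|gw] := eqVneq (p.1 - wall H p.2) w.
  apply: (in_edge _ kN').
  have kE : (H.*2 - k)%:R = 2 * h - k%:R :> R.
    by rewrite natrB// -mul2n natrM.
  by apply: RightEdge; rewrite ?kE -/h -/w; lra.
move: y_bound g_bound => /andP[y_ge yle] /andP[g_ge gle].
by case: nint; rewrite !lt_neqAle ![0 == _]eq_sym y0 yh g0 gw y_ge yle g_ge gle.
Qed.

Lemma region_body : region (@polygon R H) = body.
Proof.
apply: (region_eq body_closed body_interior_open).
- case: body_bounded => M [Mreal bM]; exists M; split=> // M' /bM{}bM p.
  case=> /andP[? ?] /andP[? ?].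
  by apply: bM; split; apply/andP; split; apply: ltW.
- by move=> p [/andP[? ?] /andP[? ?]]; split; apply/andP; split; apply: ltW.
- exact: boundary_curveE.
move=> p nbp.
have ray d : d != 0 -> (forall s, 0 <= s -> ~ body (p + s *: d)) ->
    ~ bounded_set (connected_component (~` boundary_curve (@polygon R H)) p).
  move=> d0 pd; apply: ray_unbounded d0 _ => s s0 /boundary_curveE[ps _].
  exact: (pd _ s0).
have nz (a b : R) : (a != 0) || (b != 0) -> (a, b) != 0 :> R * R.
  by rewrite -negb_and; apply: contra => /eqP[-> ->]; rewrite eqxx.
have n1 : - 1 != 0 :> R by rewrite oppr_eq0 oner_eq0.
(* Each violated inequality gives a direction of escape. A horizontal ray keeps the height, hence
   the position of the wall, so the violation only grows. *)
have [y0|y0] := ltP p.2 0.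
  apply: (ray (0, -1)) => [|s s0 []]; first by rewrite nz// n1 orbT.
  by rewrite /= /GRing.scale /= => /andP[]; lra.
have [hy|yh] := ltP h p.2.
  apply: (ray (0, 1)) => [|s s0 []]; first by rewrite nz// oner_eq0 orbT.
  by rewrite /= /GRing.scale /= -/h => /andP[]; lra.
have [g0|g0] := ltP (p.1 - wall H p.2) 0.
  apply: (ray (-1, 0)) => [|s s0 []]; first by rewrite nz// n1.
  by rewrite /= /GRing.scale /= mulr0 addr0 => _ /andP[]; lra.
have [wg|gw] := ltP w (p.1 - wall H p.2).
  apply: (ray (1, 0)) => [|s s0 []]; first by rewrite nz// oner_eq0.
  by rewrite /= /GRing.scale /= mulr0 addr0 -/w => _ /andP[]; lra.
by case: nbp; split; apply/andP.
Qed.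

(* On [0, h] the walls move by at most [h ^ 2], so the midpoint of the bottom
   edge keeps a horizontal distance of [h ^ 2] from both of them. *)
Lemma body_star_shaped : star_shaped body.
Proof.
have h1 := h_ge1; have wE := widthE.
have hh0 : 0 <= h * h by rewrite mulr_ge0//; lra.
exists (wall H 0 + 2 * h * h, 0).
  by split; rewrite /= -/h -/w; lra.
move=> p [y_bound g_bound] q [s + <-]; rewrite /= in_itv /= => /andP[s0 s1].
move: y_bound g_bound; rewrite -/h -/w => /andP[y0 yh] /andP[g0 gw].
rewrite /body /= /GRing.scale /= -/h -/w mulr0 add0r.
set y := p.2 in y0 yh g0 gw *; set x := p.1 in g0 gw *.
have sy0 : 0 <= s * y by rewrite mulr_ge0.
have syy : s * y <= y by rewrite ler_piMl.
split; first by apply/andP; split; lra.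
have lip0 : `|wall H (s * y) - wall H 0| <= h * h.
  apply: le_trans (wall_lipschitz _ _) _.
  by rewrite subr0 ger0_norm// ler_wpM2l//; lra.
have lip1 : `|wall H (s * y) - wall H y| <= (1 - s) * (h * h).
  apply: le_trans (wall_lipschitz _ _) _.
  rewrite distrC ger0_norm ?subr_ge0// mulrCA.
  have -> : y - s * y = (1 - s) * y by ring.
  by rewrite !ler_wpM2l//; lra.
have {}lip1 : s * `|wall H (s * y) - wall H y| <= (1 - s) * (h * h).
  by apply: le_trans lip1; rewrite ler_piMl.
move: lip0 lip1; rewrite -[s in s * `|_|]ger0_norm// -normrM !ler_norml.
(* The gap at the new point is [(1 - s) (wall 0 - wall (s y) + 2 h^2) + s (x - wall y) + s (wall y -
   wall (s y))]. It is at least [(1 - s) h^2 - (1 - s) h^2 = 0] and at most [3 (1 - s) h^2 + 4 s h^2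
   + (1 - s) h^2 = 4 h^2], the width. *)
have t0 : 0 <= 1 - s by lra.
move=> /andP[l0 u0]; have := ler_wpM2l t0 l0; have := ler_wpM2l t0 u0.
have := ler_wpM2l s0 g0; have := ler_wpM2l s0 gw.
rewrite wE; move: (wall H (s * y)) (wall H 0) (wall H y) => a b c.
by move=> ? ? ? ? /andP[? ?]; apply/andP; split; lra.
Qed.

(** * Lattice points in the dilates *)

Lemma wall_irrational (q : rat) : irrational (wall H (ratr q) : R).
Proof.
have [r rE] := kinks_rational R H q.
move=> [r' _ r'E]; apply: (@pi_irrationnal R); exists (r' - r) => //.
by rewrite rmorphB /= r'E /wall rE addrK.
Qed.

Lemma ehrhart_body (t : nat) : (0 < t)%N ->
  ehrhart body t = ((t * H).+1 * (width H * t))%N.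
Proof.
move=> t0; have t0R : 0 < t%:R :> R by rewrite ltr0n.
(* The abscissa at which the slice of the dilate at height [k] begins. *)
pose left k : R := t%:R * wall H (k%:R / t%:R).
have left_nint k (z : int) : left k != z%:~R.
  apply/eqP => lz; have := @wall_irrational (k%:R / t%:R).
  rewrite fmorph_div /= !ratr_nat; apply.
  exists (z%:~R / t%:R) => //.
  rewrite fmorph_div /= ratr_int ratr_nat -lz.
  by rewrite /left mulrC mulKf ?gt_eqF.
(* The slice at height [k] has length [width H * t] and a non-integer left end, so its integers are
   the [width H * t] consecutive ones that start at [floor (left k) + 1]. *)
pose point (kj : 'I_(t * H).+1 * 'I_(width H * t)) : R * R :=
  ((Num.floor (left kj.1) + 1 + kj.2%:Z)%:~R, (kj.1 : nat)%:R).
have point_inj : injective point.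
  move=> [k j] [k' j'] [] /= /eqP + /eqP; rewrite eqr_nat eqr_int.
  move=> + /eqP/val_inj kk; rewrite kk => /eqP/addrI[] /val_inj ->//.
rewrite /ehrhart.
suff -> : [set t%:R *: x | x in body] `&` @int_lattice R =
    [set` [fset point kj | kj in {: 'I_(t * H).+1 * 'I_(width H * t)}]%fset].
  by rewrite set_fsetK card_imfset//= -cardE card_prod !card_ord.
apply/seteqP; split=> [z [[p [/andP[y0 yh] /andP[g0 gw]] <-]]|z].
  move: y0 yh g0 gw; case: p => x y /= y0 yh g0 gw.
  case=> /= /intrP[a aE] /intrP[b bE].
  rewrite /GRing.scale /= in aE bE.
  have b0 : 0 <= b by rewrite -(@ler0z R) -bE mulr_ge0.
  have bk : t%:R * y = `|b|%N%:R by rewrite natr_absz ger0_norm.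
  have kN : (`|b| < (t * H).+1)%N.
    by rewrite ltnS -(@ler_nat R) -bk natrM ler_wpM2l.
  have leftE : left `|b|%N = t%:R * wall H y.
    by rewrite /left -bk [t%:R * y]mulrC mulfK ?gt_eqF.
  (* Strictness comes from [left_nint]; it makes the smallest possible abscissa [f + 1] rather than
     [f]. *)
  have la : left `|b|%N < a%:~R.
    by rewrite lt_neqAle left_nint leftE -aE ler_wpM2l// -subr_ge0.
  have au : a%:~R <= left `|b|%N + (width H * t)%:R.
    rewrite leftE -aE natrM [_ * t%:R]mulrC -mulrDr.
    by rewrite ler_wpM2l//; lra.
  have /andP[fl lf] := floor_itv (left `|b|%N).
  set f := Num.floor (left `|b|%N) in fl lf.
  have fa : f + 1 <= a by rewrite lezD1 -(@ltr_int R); exact: le_lt_trans la.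
  have af : a < f + 1 + (width H * t)%:Z.
    rewrite -(@ltr_int R) intrD; apply: le_lt_trans au _.
    by rewrite ltrD2r.
  have jN : (`|(a - (f + 1))%R| < width H * t)%N by lia.
  apply/imfsetP; exists (Ordinal kN, Ordinal jN) => //=.
  by rewrite /point /= -/f gez0_abs ?subr_ge0//
     [f + 1 + _]addrC subrK -aE -bk.
move=> /imfsetP[[k j] _ ->]; split; last first.
  by split; [exact: intr_int|exact: natr_int].
have /andP[fl lf] := floor_itv (left k).
set f := Num.floor (left k) in fl lf.
(* Together with [f <= left k], this puts [f + 1 + j] at or before the right end of the slice. *)
have jw : j%:R + 1 <= (width H * t)%:R :> R by rewrite natr1 ler_nat.
exists ((f + 1 + j%:Z)%:~R / t%:R, k%:R / t%:R); last first.
  rewrite /point /= -/f /GRing.scale /=.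
  by congr pair; rewrite /GRing.scale /= mulrC divfK ?gt_eqF.
have kH : k%:R <= t%:R * H%:R :> R by rewrite -natrM ler_nat -ltnS.
have wallE : wall H (k%:R / t%:R) = left k / t%:R.
  by rewrite /left [t%:R * _]mulrC mulfK ?gt_eqF.
rewrite natrM in jw; move: lf; rewrite !intrD => lf.
have j0 : 0 <= j%:R :> R by [].
split; rewrite /= ?wallE -?mulrBl ler_pdivrMr//.
  by rewrite divr_ge0// mulrC.
by rewrite divr_ge0//=; lra.
Qed.

Lemma polygon_irrational (i : 'I_(H.+1).*2) : irrational (@polygon R H i).1.
Proof.
rewrite /polygon /vertex; case: ifP => _ /=.
  by rewrite -(ratr_nat R); exact: wall_irrational.
rewrite -[(_ - _)%N%:R](ratr_nat R) => -[q _ qE].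
apply: (@wall_irrational (H.*2.+1 - i)%:R); exists (q - (width H)%:R) => //.
by rewrite rmorphB /= qE !ratr_nat addrK.
Qed.

Lemma ehrhart_polynomial_body : ehrhart_polynomial body.
Proof.
exists ((H%:R *: 'X + 1) * ((width H)%:R *: 'X)) => t t0.
rewrite ehrhart_body// natrM -natr1 (natrM _ t) (natrM _ (width H)) !hornerE.
by rewrite [t%:R * _]mulrC.
Qed.

End Body.

Theorem theorem1p4 (R : realType) (N : nat) (hN : (4 <= N)%N)
    (hNeven : ~~ odd N) :
  exists v : 'I_N -> (R * R)%type,
    [/\ simple_polygon v,
        star_shaped (region v),
        forall i, irrational_point (v i),
        ehrhart_polynomial (region v) &
        period_collapse v].
Proof.
have [H H_gt0 ->] : exists2 H, (0 < H)%N & N = (H.+1).*2.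
  by exists (N./2.-1); lia.
have irr i : irrational (@polygon R H i).1 by exact: polygon_irrational.
exists (@polygon R H); rewrite /period_collapse (region_body R H_gt0).
have poly_body := @ehrhart_polynomial_body R H H_gt0.
split=> //; first exact: polygon_simple.
- exact: body_star_shaped.
- by move=> i; left.
split=> // int_polygon.
have [/intrP[z zE] _] := int_polygon ord0.
by apply: (irr ord0); exists z%:~R; rewrite // ratr_int zE.
Qed.
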